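(* For every integer $n\ge 3$, the sunlet graph $L_n$ on $2n$ vertices satisfies $$\alpha(L_n)+\alpha(L(L_n))=2n \quad\text{and}\quad \alpha(L_n)\cdot\alpha(L(L_n))=n^2 .$$
   Context: The $n$-sunlet graph $L_n$ is the graph on $2n$ vertices obtained by attaching $n$ pendant edges to the cycle graph $C_n$, one at each vertex of the cycle. For a graph $G$, $\alpha(G)$ denotes its independence number, i.e. the maximum cardinality of a set of pairwise non-adjacent vertices of $G$. $L(G)$ denotes the line graph of $G$ (so $L(L_n)$ is the line graph of the sunlet graph $L_n$): its vertices are in one-to-one correspondence with the edges of $G$, and two vertices of $L(G)$ are adjacent if and only if the corresponding edges of $G$ are adjacent (share an endpoint). *)

(* Defs.v *)
From mathcomp Require Import all_boot.
Set Implicit Arguments.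
Unset Strict Implicit.
Unset Printing Implicit Defensive.

Record sgraph := SGraph {
  vertex :> finType;
  adj : rel vertex;
  adj_sym : symmetric adj;
  adj_irrefl : irreflexive adj
}.

Definition edges (G : sgraph) : {set {set G}} :=
  [set [set p.1; p.2] | p : G * G & adj p.1 p.2].

Definition independent (G : sgraph) (S : {set G}) : bool :=
  [forall x in S, forall y in S, ~~ adj x y].

Definition alpha (G : sgraph) : nat :=
  \max_(S : {set G} | independent S) #|S|.

Section LineGraph.
Variable G : sgraph.

Definition edge_type : finType := {e : {set G} | e \in edges G}.

Definition line_adj : rel edge_type :=
  fun e f => (e != f) && (val e :&: val f != set0).

Lemma line_adj_sym : symmetric line_adj.
Proof. by move=> e f; rewrite /line_adj eq_sym setIC. Qed.

Lemma line_adj_irrefl : irreflexive line_adj.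
Proof. by move=> e; rewrite /line_adj eqxx. Qed.

Definition line_graph : sgraph := SGraph line_adj_sym line_adj_irrefl.
End LineGraph.

Section Cycle.
Variable n : nat.

(* [ordS i] is the cyclic successor i + 1 mod n.  The conjunct [i != j] only
   matters for n = 1, where [ordS i = i]. *)
Definition cycle_adj : rel 'I_n :=
  fun i j => (i != j) && ((j == ordS i) || (i == ordS j)).

Lemma cycle_adj_sym : symmetric cycle_adj.
Proof. by move=> i j; rewrite /cycle_adj eq_sym orbC. Qed.

Lemma cycle_adj_irrefl : irreflexive cycle_adj.
Proof. by move=> i; rewrite /cycle_adj eqxx. Qed.

Definition cycle_graph : sgraph := SGraph cycle_adj_sym cycle_adj_irrefl.
End Cycle.

Section Pendant.
Variable G : sgraph.

(* [inl x] is the original vertex x and [inr x] is the leaf attached to it. *)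
Definition pendant_adj : rel (G + G)%type :=
  fun u v => match u, v with
  | inl x, inl y => adj x y
  | inl x, inr y | inr x, inl y => x == y
  | inr _, inr _ => false
  end.

Lemma pendant_adj_sym : symmetric pendant_adj.
Proof. by move=> [x|x] [y|y] //=; exact: adj_sym. Qed.

Lemma pendant_adj_irrefl : irreflexive pendant_adj.
Proof. by move=> [x|x] //=; exact: adj_irrefl. Qed.

Definition attach_pendants : sgraph :=
  SGraph pendant_adj_sym pendant_adj_irrefl.
End Pendant.

Definition sunlet (n : nat) : sgraph := attach_pendants (cycle_graph n).

Lemma card_sunlet (n : nat) : #|sunlet n| = 2 * n.
Proof. by rewrite card_sum card_ord mul2n addnn. Qed.

(* Main.v *)
Require Import Defs.
From mathcomp Require Import all_boot.

(** Attaching a leaf at every vertex of any graph G makes both independence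
    numbers equal to #|G|. In G with pendants, each vertex x with its leaf forms
    a clique, and these #|G| cliques cover all vertices. In the line graph, every
    edge has an endpoint in G, and the edges through a given x in G form a clique.
    The leaves, respectively the pendant edges, attain the bound. *)

(* [f] indexes a clique cover by [T], and [g] an independent family by [T]. *)
Lemma alpha_clique_cover (G : sgraph) (T : finType) (f : G -> T) (g : T -> G) :
    (forall x y, x != y -> f x = f y -> adj x y) ->
    injective g -> (forall s t, ~~ adj (g s) (g t)) ->
  alpha G = #|T|.
Proof.
move=> f_clique g_inj g_indep; apply/eqP; rewrite eqn_leq; apply/andP; split.
  apply/bigmax_leqP => S /forall_inP indS.
  (* Each fibre of [f] is a clique, so it meets the independent set [S] at most once. *)
  have f_inj : {in S &, injective f}.
    move=> x y xS yS fxy; apply: contraTeq (indS x xS) => xy.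
    apply/negP => /forall_inP/(_ y yS).
    by rewrite f_clique.
  by rewrite -(card_in_imset f_inj) max_card.
rewrite -cardsT -(card_imset _ g_inj).
apply: (leq_bigmax_cond (F := fun S : {set G} => #|S|)).
apply/forall_inP => _ /imsetP[s _ ->].
by apply/forall_inP => _ /imsetP[t _ ->].
Qed.

Lemma alpha_attach_pendants (G : sgraph) : alpha (attach_pendants G) = #|G|.
Proof.
pose base (u : attach_pendants G) : G := match u with inl x | inr x => x end.
apply: (@alpha_clique_cover _ _ base inr) => //; last by move=> x y [].
by move=> [x|x] [y|y] //= nxy exy; move: nxy; rewrite exy eqxx.
Qed.

(** Leaves are pairwise non-adjacent, so no edge joins two of them. *)
Lemma edge_attach_pendants_base (G : sgraph)
    (e : line_graph (attach_pendants G)) :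
  exists x : G, inl x \in val e.
Proof.
case/imsetP: (valP e) => -[[x|x] [y|y]]; rewrite inE //= => _ ->.
- by exists x; rewrite !inE eqxx.
- by exists x; rewrite !inE eqxx.
- by exists y; rewrite !inE eqxx orbT.
Qed.

Lemma pendant_edge_in (G : sgraph) (x : G) :
  [set inl x; inr x] \in edges (attach_pendants G).
Proof. by apply/imsetP; exists (inl x, inr x); rewrite ?inE /=. Qed.

Lemma alpha_line_attach_pendants (G : sgraph) :
  alpha (line_graph (attach_pendants G)) = #|G|.
Proof.
(* An edge inside [G] offers two endpoints; either will do, since edges with the same chosen
   endpoint meet there. *)
pose base e := xchoose (edge_attach_pendants_base G e).
pose pendant (x : G) : line_graph (attach_pendants G) :=
  Sub [set inl x; inr x] (pendant_edge_in G x).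
have base_in e : inl (base e) \in val e.
  exact: (xchooseP (edge_attach_pendants_base G e)).
have pendant_inl x y : (inl y \in val (pendant x)) = (y == x).
  by rewrite !inE orbF.
have pendant_inr x y : (inr y \in val (pendant x)) = (y == x).
  by rewrite !inE.
apply: (@alpha_clique_cover _ _ base pendant) => [e f nef bef|x y pxy|x y].
- rewrite /= /line_adj nef; apply/set0Pn; exists (inl (base e)).
  by rewrite inE base_in bef base_in.
- by apply/eqP; rewrite -pendant_inl -pxy pendant_inl.
- rewrite /= /line_adj negb_and !negbK.
  have [->|nxy] := eqVneq x y; first by rewrite eqxx.
  (* A common vertex, [inl z] or [inr z], would force both [z = x] and [z = y]. *)
  apply/orP; right; apply/eqP/setP => -[z|z];
    rewrite inE ?pendant_inl ?pendant_inr in_set0;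
    by case: eqP => // ->; apply: negbTE.
Qed.

Theorem theorem2p14 (n : nat) (hn : 3 <= n) :
  alpha (sunlet n) + alpha (line_graph (sunlet n)) = 2 * n /\
  alpha (sunlet n) * alpha (line_graph (sunlet n)) = n ^ 2.
Proof.
rewrite alpha_attach_pendants alpha_line_attach_pendants card_ord.
by rewrite mul2n addnn mulnn.
Qed.
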